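(* Let $0<p<1$ and $f=p/(1-p)$. For $n\ge 1$ and $k\in\{0,\ldots,2^n-1\}$ let $p_k=p_{k,n}=p^{\#1}(1-p)^{\#0}$, where $\#1$ and $\#0$ are the numbers of ones and zeros in the $n$-digit binary representation of $k$; for a binary vector $v$ let $p(v)=p^{\#1(v)}(1-p)^{\#0(v)}$. (i) Let ${\bf s}_{ij}$ be a binary vector of length $n=i+j$ with exactly $i$ ones and $j$ zeros. Then $$\frac{p({\bf s}_{ij},1)}{p({\bf s}_{ij},0)}=\frac{p(1,{\bf s}_{ij})}{p(0,{\bf s}_{ij})}=\frac{p^{i+1}(1-p)^j}{p^i(1-p)^{j+1}}=\frac{p}{1-p}=f .$$ In particular, $p_{2l+1}/p_{2l}=f$ for $l=0,1,\ldots,2^{n-1}-1$. Moreover, $$\frac{p(0,1,{\bf s}_{ij})}{p(1,0,{\bf s}_{ij})}=\frac{p(0,{\bf s}_{ij},1)}{p(1,{\bf s}_{ij},0)}=\frac{p({\bf s}_{ij},0,1)}{p({\bf s}_{ij},1,0)}=1 .$$ (ii) For $n=1,2,\ldots$, $p_0=p_0(n)=(1-p)^n$, and $p_k=p_0\cdot f^{\#1}$ for $k=0,\ldots,2^n-1$, where $\#1$ is the number of ones in the binary representation of $k$. That is, the vector of probabilities ${\bf p}_n=(p_0,p_1,\ldots,p_{2^n-1})$ can be written as ${\bf p}_n=p_0\cdot{\bf f}_n$ with $${\bf f}_n=(1;f;f,f^2;f,f^2,f^2,f^3;\ldots;f,f^2,f^2,f^3,\ldots,f^{n-2},f^{n-1},f^{n-1},f^n),$$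 whose entry with index $k$ is $f^{\#1}$. (iii) With ${\bf p}_0=1$, the vector ${\bf f}_n$ has dimension $2^n$ and satisfies ${\bf f}_0=1$ and ${\bf f}_n=({\bf f}_{n-1},\,f\cdot{\bf f}_{n-1})$ for $n=1,2,\ldots$. Moreover, neighbouring blocks are separated by the factor $f$: for $0\le m<n$ and $0\le l<2^{n-m-1}$, the block of entries of ${\bf f}_n$ with indices $l2^{m+1}+2^m,\ldots,(l+1)2^{m+1}-1$ equals $f$ times the block of entries with indices $l2^{m+1},\ldots,l2^{m+1}+2^m-1$. (iv) The successive vectors ${\bf f}_0,{\bf f}_1,{\bf f}_2,\ldots$ are also obtained by the following local rule: start with the single entry $1$; to pass from row $n$ to row $n+1$, replace each entry $x$ of row $n$ by the two consecutive entries $x,\ f x$. (v) Replace every entry $f^e$ of ${\bf f}_n$ by its exponent $e$ (the logarithm to base $f$), yielding the rows $0$; $0,1$; $0,1,1,2$; $0,1,1,2,1,2,2,3$; $\ldots$, and let $s_n$ be the sum of the exponents in row $n$. Then $s_0=0$ and $s_{n+1}=2s_n+2^n$ for $n=0,1,\ldots$; that is, one obtains the sequence $0,1,4,12,32,80,192,448,1024,2304,\ldots$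
   Context: Expressions such as $({\bf s},1)$, $(1,{\bf s})$, $(0,1,{\bf s})$, $(0,{\bf s},1)$ denote concatenations of binary vectors, and $({\bf u},{\bf v})$ denotes concatenation of vectors. Entries of ${\bf f}_n$ and ${\bf p}_n$ are indexed by $k=0,\ldots,2^n-1$. In (v), when $f=1$ the exponent of the entry with index $k$ is understood formally, i.e. as the number of ones in the binary representation of $k$. *)

(* Defs.v *)
From mathcomp Require Export all_boot all_order all_algebra.
From mathcomp Require Export reals exp.

Set Implicit Arguments.
Unset Strict Implicit.
Unset Printing Implicit Defensive.

Import GRing.Theory Num.Theory.
Local Open Scope ring_scope.

(* Binary vectors are bit sequences, with true for the digit 1 and false for
   the digit 0. *)
Definition ones (v : bitseq) : nat := count_mem true v.
Definition zeros (v : bitseq) : nat := count_mem false v.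

(* Most significant digit first: the digit at position i has weight
   2 ^ (n - 1 - i). *)
Definition digits (n k : nat) : bitseq :=
  mkseq (fun i => odd (k %/ 2 ^ (n.-1 - i))) n.

(* Without leading zeros, except that 0 is represented by the single digit 0
   (trunc_log 2 0 = 0). *)
Definition binrep (k : nat) : bitseq := digits (trunc_log 2 k).+1 k.

Definition prob (R : realType) (p : R) (v : bitseq) : R :=
  p ^+ ones v * (1 - p) ^+ zeros v.

Definition pk (R : realType) (p : R) (n k : nat) : R := prob p (digits n k).

Definition pvec (R : realType) (p : R) (n : nat) : seq R :=
  mkseq (pk p n) (2 ^ n).

Definition fvec (R : realType) (f : R) (n : nat) : seq R :=
  mkseq (fun k => f ^+ ones (binrep k)) (2 ^ n).

(* The entries with indices a, ..., b - 1. *)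
Definition slice (T : Type) (a b : nat) (v : seq T) : seq T :=
  drop a (take b v).

Definition local_rule (R : realType) (f : R) (row : seq R) : seq R :=
  flatten [seq [:: x; f * x] | x <- row].

(* Formal exponents of the entries of fvec f n: they do not depend on f, and
   make sense for f = 1 as well. *)
Definition expvec (n : nat) : seq nat :=
  mkseq (fun k => ones (binrep k)) (2 ^ n).

Definition expsum (n : nat) : nat := sumn (expvec n).

(* Main.v *)
Require Import Defs.
From mathcomp Require Import all_boot all_order all_algebra.
From mathcomp Require Import reals exp.
From mathcomp Require Import zify ring.

Set Implicit Arguments.
Unset Strict Implicit.
Unset Printing Implicit Defensive.

Import GRing.Theory Num.Theory.
Local Open Scope ring_scope.

(** Everything rests on one fact about binary expansions: for [r < 2 ^ m], the
    expansion of [l * 2 ^ m + r] is that of [l] followed by the [m] digits of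
    [r] ([digits_cat]).  Writing [popcount k] for the number of ones of [k],
    this says [popcount (l * 2 ^ m + r) = popcount l + popcount r]
    ([popcount_cat]); leading zeros contribute nothing, so the number of ones
    may be read off any sufficiently long expansion.

    Digits contribute independent factors to a probability: it is
    multiplicative under concatenation ([prob_cat]) and blind to the order of
    the digits ([prob_perm]), hence the ratios for a single exchanged digit and
    for two swapped ones.  Exchanging a zero for a one multiplies the
    probability by the odds [f], so a vector [v] of length [n] has probability
    [(1 - p) ^ n * f ^ #1(v)] ([prob_odds]); as [digits n k] has [popcount k]
    ones ([ones_digits]), the vector of probabilities is a multiple of [f_n].

    The shape of [f_n] is then additivity of [popcount], read through
    the exponential: the aligned block of length [2 ^ m] with number [l] in
    any [f_n] is [f ^ popcount l] times [f_m] ([slice_fvec]).  All displayed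
    blocks, and the factor [f] between the neighbouring blocks [2 l] and
    [2 l + 1], are instances.  Splitting an index at its top bit gives the
    concatenation recurrence, and hence the recurrence for the sums of
    exponents; splitting it at its bottom bit gives the local rule. *)

(** * Binary expansions *)

Definition popcount (k : nat) : nat := ones (binrep k).

Lemma digits_cat n m l r : (r < 2 ^ m)%N ->
  digits (n + m) (l * 2 ^ m + r) = digits n l ++ digits m r.
Proof.
move=> lt_r; apply: (@eq_from_nth _ false).
  by rewrite size_cat !size_mkseq.
move=> i; rewrite size_mkseq => lt_i; rewrite nth_cat size_mkseq nth_mkseq //.
case: ltnP => [lt_in | le_ni].
  (* A high digit: dividing by 2 ^ m first discards r. *)
  rewrite nth_mkseq //.
  have -> : ((n + m).-1 - i = m + (n.-1 - i))%N by lia.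
  by rewrite expnD divnMA divnMDl ?expn_gt0 // (divn_small lt_r) addn0.
(* A low digit: l contributes a multiple of 2 to the quotient. *)
have lt_im : (i - n < m)%N by lia.
rewrite nth_mkseq //; have -> : ((n + m).-1 - i = m.-1 - (i - n))%N by lia.
set e := (m.-1 - (i - n))%N.
have -> : (m = (m - e.+1) + 1 + e)%N by rewrite /e; lia.
by rewrite expnD mulnA divnMDl ?expn_gt0 // oddD oddM oddX addn1 /= andbF.
Qed.

Lemma digits0 n : digits n 0 = nseq n false.
Proof.
apply: (@eq_from_nth _ false); rewrite size_mkseq ?size_nseq // => i lt_i.
by rewrite nth_mkseq // div0n nth_nseq lt_i.
Qed.

Lemma ones_cat u v : ones (u ++ v) = (ones u + ones v)%N.
Proof. exact: count_cat. Qed.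

Lemma ones_digits0 n : ones (digits n 0) = 0%N.
Proof. by rewrite digits0 /ones count_nseq. Qed.

Lemma ones_digits_widen n m k : (k < 2 ^ m)%N ->
  ones (digits (n + m) k) = ones (digits m k).
Proof.
move/(digits_cat n 0); rewrite mul0n add0n => ->.
by rewrite ones_cat ones_digits0.
Qed.

Lemma ones_digits n k : (k < 2 ^ n)%N -> ones (digits n k) = popcount k.
Proof.
move=> lt_k; have lt_kt : (k < 2 ^ (trunc_log 2 k).+1)%N by exact: trunc_log_ltn.
(* Both expansions are compared with a common widening. *)
by rewrite -(ones_digits_widen (trunc_log 2 k).+1 lt_k) addnC ones_digits_widen.
Qed.

Lemma popcount_cat m l r : (r < 2 ^ m)%N ->
  popcount (l * 2 ^ m + r) = (popcount l + popcount r)%N.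
Proof.
move=> lt_r; have lt_l : (l < 2 ^ l)%N by exact: ltn_expl.
rewrite -(ones_digits lt_l) -(ones_digits lt_r) -ones_cat -digits_cat //.
rewrite ones_digits // expnD; set a := (2 ^ l)%N in lt_l *.
set b := (2 ^ m)%N in lt_r *; apply: leq_trans (_ : l.+1 * b <= _)%N.
  by rewrite mulSn; lia.
by rewrite leq_mul2r lt_l orbT.
Qed.

Lemma popcount0 : popcount 0 = 0%N. Proof. by []. Qed.

Lemma popcount1 : popcount 1 = 1%N. Proof. by []. Qed.

Lemma popcount_double k : popcount (2 * k) = popcount k.
Proof. by rewrite mulnC -[(k * 2)%N]addn0 (@popcount_cat 1 k 0) ?addn0. Qed.

Lemma popcount_doubleS k : popcount (2 * k + 1) = (popcount k).+1.
Proof. by rewrite mulnC (@popcount_cat 1 k 1) ?addn1. Qed.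

Lemma popcount_topbit n k : (k < 2 ^ n)%N ->
  popcount (2 ^ n + k) = (popcount k).+1.
Proof. by move/(popcount_cat 1); rewrite mul1n popcount1 add1n. Qed.

Lemma popcount_exp2 n : popcount (2 ^ n) = 1%N.
Proof. by have := @popcount_topbit n 0; rewrite expn_gt0 addn0 popcount0 => ->. Qed.

Lemma popcount_exp2B1 n : popcount (2 ^ n - 1) = n.
Proof.
elim: n => [//|n IHn].
have -> : (2 ^ n.+1 - 1 = 2 * (2 ^ n - 1) + 1)%N.
  by have := expn_gt0 2 n; rewrite expnS; lia.
by rewrite popcount_doubleS IHn.
Qed.

(** * Probabilities of binary vectors *)

Section Probabilities.

Variables (R : realType) (p : R).

Lemma prob_cat u v : prob p (u ++ v) = prob p u * prob p v.
Proof. by rewrite /prob /ones /zeros !count_cat !exprD mulrACA. Qed.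

Lemma prob_perm u v : perm_eq u v -> prob p u = prob p v.
Proof. by move/permP=> eq_uv; rewrite /prob /ones /zeros !eq_uv. Qed.

Lemma prob_true : prob p [:: true] = p.
Proof. by rewrite /prob /= expr1 expr0 mulr1. Qed.

Lemma prob_false : prob p [:: false] = 1 - p.
Proof. by rewrite /prob /= expr1 expr0 mul1r. Qed.

Lemma prob_neq0 v : p != 0 -> 1 - p != 0 -> prob p v != 0.
Proof. by move=> *; rewrite mulf_neq0 ?expf_neq0. Qed.

Lemma prob_odds v : 1 - p != 0 ->
  prob p v = (1 - p) ^+ size v * (p / (1 - p)) ^+ ones v.
Proof.
move=> q_neq0; elim: v => [|b v IHv]; first by rewrite /prob /= !expr0.
have Eb : prob p [:: b] = (1 - p) * (p / (1 - p)) ^+ b.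
  case: b; first by rewrite prob_true expr1 mulrC divfK.
  by rewrite prob_false expr0 mulr1.
rewrite -cat1s prob_cat ones_cat Eb IHv exprD mulrACA -exprS.
by case: b {Eb}.
Qed.

Lemma pk0 n : pk p n 0 = (1 - p) ^+ n.
Proof.
by rewrite /pk /prob digits0 /ones /zeros !count_nseq /= mul0n mul1n expr0 mul1r.
Qed.

Lemma pk_odds n k : 1 - p != 0 -> (k < 2 ^ n)%N ->
  pk p n k = pk p n 0 * (p / (1 - p)) ^+ popcount k.
Proof.
by move=> q_neq0 lt_k; rewrite {1}/pk prob_odds // size_mkseq ones_digits // pk0.
Qed.

End Probabilities.

(** * Blocks and recurrences *)

Lemma mkseqD (T : Type) (g : nat -> T) a b :
  mkseq g (a + b) = mkseq g a ++ mkseq (fun i => g (a + i)%N) b.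
Proof.
by rewrite /mkseq iotaD map_cat add0n -{2}[a]addn0 iotaDl -map_comp.
Qed.

Lemma mkseq_double (T : Type) (g : nat -> T) a :
  mkseq g (2 * a) = flatten (mkseq (fun k => [:: g (2 * k); g (2 * k + 1)]%N) a).
Proof.
elim: a => [|a IHa]; first by rewrite muln0.
rewrite mulnS addnC mkseqD IHa -[a.+1]addn1 mkseqD flatten_cat.
by rewrite {2 4}/mkseq /= !addn0.
Qed.

Lemma slice_mkseq (T : Type) (g : nat -> T) a b n : (a + b <= n)%N ->
  slice a (a + b) (mkseq g n) = mkseq (fun i => g (a + i)%N) b.
Proof.
move=> le_n; rewrite -(subnKC le_n) mkseqD /slice take_size_cat ?size_mkseq //.
by rewrite mkseqD drop_size_cat ?size_mkseq.
Qed.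

Lemma expvecS n : expvec n.+1 = expvec n ++ [seq e.+1 | e <- expvec n].
Proof.
rewrite /expvec expnS mul2n -addnn mkseqD; congr (_ ++ _).
rewrite -map_comp; apply/eq_in_map => k; rewrite mem_iota => /andP[_ lt_k].
exact: popcount_topbit.
Qed.

Lemma sumn_map_succ (s : seq nat) :
  sumn [seq e.+1 | e <- s] = (sumn s + size s)%N.
Proof. by elim: s => //= e s ->; lia. Qed.

Lemma expsumS n : expsum n.+1 = (2 * expsum n + 2 ^ n)%N.
Proof.
by rewrite /expsum expvecS sumn_cat sumn_map_succ size_mkseq addnA addnn mul2n.
Qed.

Section ExponentVectors.

Variables (R : realType) (f : R).

Lemma fvec_expvec n : fvec f n = [seq f ^+ e | e <- expvec n].
Proof. by rewrite /fvec /expvec /mkseq -map_comp. Qed.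

Lemma fvec0 : fvec f 0 = [:: 1]. Proof. by rewrite fvec_expvec /= expr0. Qed.

Lemma fvecS n : fvec f n.+1 = fvec f n ++ [seq f * x | x <- fvec f n].
Proof.
rewrite !fvec_expvec expvecS map_cat -!map_comp; congr (_ ++ _).
by apply: eq_map => e /=; rewrite exprS.
Qed.

(** The vectors are self-similar: fixing the high bits [l] of an index leaves
    [m] free low bits, and multiplies the entries by a constant. *)
Lemma slice_fvec n m l : (l.+1 * 2 ^ m <= 2 ^ n)%N ->
  slice (l * 2 ^ m) (l.+1 * 2 ^ m) (fvec f n)
    = [seq f ^+ popcount l * x | x <- fvec f m].
Proof.
rewrite mulSn addnC => /slice_mkseq ->; rewrite /fvec -map_comp.
apply/eq_in_map => r; rewrite mem_iota => /andP[_ lt_r] /=.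
by rewrite -exprD -(popcount_cat l lt_r).
Qed.

Lemma fvec_local_rule n : fvec f n.+1 = local_rule f (fvec f n).
Proof.
rewrite /fvec expnS mkseq_double /local_rule -map_comp; congr flatten.
apply: eq_map => k; rewrite -/(popcount (2 * k)) -/(popcount (2 * k + 1)).
by rewrite popcount_double popcount_doubleS exprS.
Qed.

Lemma fvec_iter n : fvec f n = iter n (local_rule f) [:: 1].
Proof. by elim: n => [|n IHn] /=; rewrite ?fvec0 // -IHn fvec_local_rule. Qed.

Lemma fvec1 : fvec f 1 = [:: 1; f].
Proof. by rewrite fvecS fvec0 /= mulr1. Qed.

Lemma fvec2 : fvec f 2 = [:: 1; f; f; f ^+ 2].
Proof. by rewrite fvecS fvec1 /= mulr1 expr2. Qed.

Lemma block_factor n m l : (m < n)%N -> (l < 2 ^ (n - m - 1))%N ->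
  slice (l * 2 ^ m.+1 + 2 ^ m) (l.+1 * 2 ^ m.+1) (fvec f n)
    = [seq f * x | x <-
         slice (l * 2 ^ m.+1) (l * 2 ^ m.+1 + 2 ^ m) (fvec f n)].
Proof.
move=> lt_mn lt_l.
have le_n : ((2 * l).+2 * 2 ^ m <= 2 ^ n)%N.
  have -> : (n = (n - m - 1) + 1 + m)%N by lia.
  by rewrite !expnD leq_mul2r; apply/orP; right; lia.
(* The two blocks of length 2 ^ m are those numbered 2 l and 2 l + 1. *)
have -> : (l * 2 ^ m.+1 = (2 * l) * 2 ^ m)%N by rewrite expnS; lia.
have -> : (l.+1 * 2 ^ m.+1 = (2 * l).+2 * 2 ^ m)%N by rewrite expnS; lia.
have -> : (2 * l * 2 ^ m + 2 ^ m = (2 * l).+1 * 2 ^ m)%N by lia.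
rewrite !slice_fvec //; last first.
  by apply: leq_trans le_n; rewrite leq_mul2r; apply/orP; right; lia.
rewrite -[in LHS]addn1 popcount_doubleS popcount_double -map_comp.
by apply: eq_map => x /=; rewrite exprS mulrA.
Qed.

Lemma fvec_first_blocks n : (1 <= n)%N ->
  [/\ slice 0 1 (fvec f n) = [:: 1],
      slice 1 2 (fvec f n) = [:: f]
    & (2 <= n)%N -> slice 2 4 (fvec f n) = [:: f; f ^+ 2]].
Proof.
move=> n_gt0; split.
- rewrite (@slice_fvec n 0 0) ?expn_gt0 // popcount0 fvec0 /=.
  by rewrite expr0 mulr1.
- rewrite (@slice_fvec n 0 1); last exact: (@leq_pexp2l 2 1 n).
  by rewrite popcount1 fvec0 /= expr1 mulr1.
- move=> n_gt1; rewrite (@slice_fvec n 1 1); last exact: (@leq_pexp2l 2 2 n).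
  by rewrite popcount1 fvec1 /= !expr1 mulr1 expr2.
Qed.

(** Inside the block of indices [2 ^ m, ..., 2 ^ (m + 1) - 1], the first four
    and last four entries are the copies of [f_2] whose high bits are
    [10...0] and [1...1] (with [m - 1] digits). *)
Lemma fvec_block_ends n m : (2 <= m < n)%N ->
  slice (2 ^ m) (2 ^ m + 4) (fvec f n) = [:: f; f ^+ 2; f ^+ 2; f ^+ 3] /\
  slice (2 ^ m.+1 - 4) (2 ^ m.+1) (fvec f n)
    = [:: f ^+ m.-1; f ^+ m; f ^+ m; f ^+ m.+1].
Proof.
case/andP; case: m => [|[|m]] // _ lt_mn.
have le_n : (2 ^ m.+3 <= 2 ^ n)%N by rewrite leq_exp2l.
have m_gt0 : (0 < 2 ^ m)%N by rewrite expn_gt0.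
have Em2 : (2 ^ m.+2 = 2 ^ m * 2 ^ 2)%N by rewrite -expnD addn2.
have Em3 : (2 ^ m.+3 = (2 ^ m.+1 - 1).+1 * 2 ^ 2)%N.
  by rewrite subn1 prednK ?expn_gt0 // -expnD addn2.
have Em1 : (2 ^ m.+1 = 2 * 2 ^ m)%N by rewrite expnS.
split.
  rewrite Em2 -[4%N]/(2 ^ 2)%N addnC -mulSn slice_fvec; last first.
    by apply: leq_trans le_n; rewrite Em3; lia.
  by rewrite popcount_exp2 fvec2 /= expr1 mulr1 -expr2 -exprS.
have -> : (2 ^ m.+3 - 4 = (2 ^ m.+1 - 1) * 2 ^ 2)%N by rewrite Em3; lia.
rewrite Em3 slice_fvec -?Em3 // popcount_exp2B1 fvec2 /=.
by rewrite mulr1 -exprSr -exprD addn2.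
Qed.

Lemma expvec_log n : 0 < f -> f != 1 ->
  [seq e%:R | e <- expvec n] = [seq ln x / ln f | x <- fvec f n].
Proof.
move=> f_gt0 f_neq1; rewrite fvec_expvec -[RHS]map_comp; apply: eq_map => e /=.
have lnf_neq0 : ln f != 0 by rewrite ln_eq0.
by rewrite lnXn // -[ln f *+ e]mulr_natl mulfK.
Qed.

End ExponentVectors.

Theorem theorem3 (R : realType) (p f : R) (p_gt0 : 0 < p) (p_lt1 : p < 1)
    (f_def : f = p / (1 - p)) :
  (* (i) *)
  ((forall (i j : nat) (s : (i + j).-tuple bool),
      ones s = i -> zeros s = j ->
      [/\ prob p (s ++ [:: true]) / prob p (s ++ [:: false])
            = prob p ([:: true] ++ s) / prob p ([:: false] ++ s),
          prob p ([:: true] ++ s) / prob p ([:: false] ++ s)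
            = (p ^+ i.+1 * (1 - p) ^+ j) / (p ^+ i * (1 - p) ^+ j.+1),
          (p ^+ i.+1 * (1 - p) ^+ j) / (p ^+ i * (1 - p) ^+ j.+1)
            = p / (1 - p)
        & p / (1 - p) = f]
      /\
      [/\ prob p ([:: false; true] ++ s) / prob p ([:: true; false] ++ s)
            = prob p ([:: false] ++ s ++ [:: true])
              / prob p ([:: true] ++ s ++ [:: false]),
          prob p ([:: false] ++ s ++ [:: true])
            / prob p ([:: true] ++ s ++ [:: false])
            = prob p (s ++ [:: false; true]) / prob p (s ++ [:: true; false])
        & prob p (s ++ [:: false; true]) / prob p (s ++ [:: true; false])
            = 1])
   /\
   (forall n l : nat, (1 <= n)%N -> (l < 2 ^ n.-1)%N ->
      pk p n (2 * l + 1)%N / pk p n (2 * l)%N = f))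
  /\
  (* (ii) *)
  (forall n : nat, (1 <= n)%N ->
     [/\ pk p n 0 = (1 - p) ^+ n,
         (forall k : nat, (k < 2 ^ n)%N ->
            pk p n k = pk p n 0 * f ^+ ones (binrep k)),
         pvec p n = [seq pk p n 0 * x | x <- fvec f n],
         (forall k : nat, (k < 2 ^ n)%N ->
            (fvec f n)`_k = f ^+ ones (binrep k))
       & (* the displayed form of f_n, in blocks with indices 2^m .. 2^(m+1)-1 *)
         [/\ slice 0 1 (fvec f n) = [:: 1],
             slice 1 2 (fvec f n) = [:: f],
             (2 <= n)%N -> slice 2 4 (fvec f n) = [:: f; f ^+ 2]
           & forall m : nat, (2 <= m < n)%N ->
               slice (2 ^ m) (2 ^ m + 4) (fvec f n)
                 = [:: f; f ^+ 2; f ^+ 2; f ^+ 3]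
               /\
               slice (2 ^ m.+1 - 4) (2 ^ m.+1) (fvec f n)
                 = [:: f ^+ m.-1; f ^+ m; f ^+ m; f ^+ m.+1]]])
  /\
  (* (iii) *)
  [/\ pvec p 0 = [:: 1],
      (forall n : nat, size (fvec f n) = (2 ^ n)%N),
      fvec f 0 = [:: 1],
      (forall n : nat, (1 <= n)%N ->
         fvec f n = fvec f n.-1 ++ [seq f * x | x <- fvec f n.-1])
    & (forall n m l : nat, (m < n)%N -> (l < 2 ^ (n - m - 1))%N ->
         slice (l * 2 ^ m.+1 + 2 ^ m) (l.+1 * 2 ^ m.+1) (fvec f n)
           = [seq f * x | x <-
                slice (l * 2 ^ m.+1) (l * 2 ^ m.+1 + 2 ^ m) (fvec f n)])]
  /\
  (* (iv) *)
  (forall n : nat, fvec f n = iter n (local_rule f) [:: 1])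
  /\
  (* (v) *)
  [/\ (forall n : nat, fvec f n = [seq f ^+ e | e <- expvec n]),
      (f != 1 -> forall n : nat,
         [seq e%:R | e <- expvec n] = [seq ln x / ln f | x <- fvec f n]),
      [/\ expvec 0 = [:: 0], expvec 1 = [:: 0; 1],
          expvec 2 = [:: 0; 1; 1; 2]
        & expvec 3 = [:: 0; 1; 1; 2; 1; 2; 2; 3]]%N,
      expsum 0 = 0%N /\
      (forall n : nat, expsum n.+1 = (2 * expsum n + 2 ^ n)%N)
    & [seq expsum n | n <- iota 0 10]
        = [:: 0; 1; 4; 12; 32; 80; 192; 448; 1024; 2304]%N].
Proof.
have p_neq0 : p != 0 by exact: lt0r_neq0.
have q_gt0 : 0 < 1 - p by rewrite subr_gt0.
have q_neq0 : 1 - p != 0 by exact: lt0r_neq0.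
have f_gt0 : 0 < f by rewrite f_def divr_gt0.
split; [split | split; [| split; [| split]]].
- move=> i j s _ _; have s_neq0 := prob_neq0 s p_neq0 q_neq0.
  have odds_ij : p ^+ i.+1 * (1 - p) ^+ j / (p ^+ i * (1 - p) ^+ j.+1)
                 = p / (1 - p).
    have pi_neq0 : p ^+ i != 0 by rewrite expf_neq0.
    have qj_neq0 : (1 - p) ^+ j != 0 by rewrite expf_neq0.
    by rewrite !exprS; field; rewrite q_neq0 qj_neq0 pi_neq0.
  have oddsl : prob p ([:: true] ++ s) / prob p ([:: false] ++ s)
               = p / (1 - p).
    by rewrite !prob_cat prob_true prob_false; field; rewrite q_neq0 s_neq0.
  have perm_ratio u v : perm_eq u v -> prob p u / prob p v = 1.
    by move=> /prob_perm ->; rewrite divff ?prob_neq0.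
  have swap_l : perm_eq ([:: false; true] ++ s) ([:: true; false] ++ s).
    by rewrite perm_cat2r.
  have swap_mid :
      perm_eq ([:: false] ++ s ++ [:: true]) ([:: true] ++ s ++ [:: false]).
    by rewrite perm_catC perm_sym perm_catC -!catA perm_cat2l.
  have swap_r : perm_eq (s ++ [:: false; true]) (s ++ [:: true; false]).
    by rewrite perm_cat2l.
  split; split; rewrite ?odds_ij ?oddsl //.
  + by rewrite !prob_cat prob_true prob_false; field; rewrite q_neq0 s_neq0.
  + by rewrite !perm_ratio.
  + by rewrite !perm_ratio.
  + exact: perm_ratio.
- case=> // n l _ lt_l; rewrite /pk -addn1 mulnC.
  rewrite (@digits_cat n 1 l 1) // -[(l * 2)%N]addn0 (@digits_cat n 1 l 0) //.
  rewrite !prob_cat prob_true prob_false f_def; field.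
  by rewrite q_neq0 prob_neq0.
- move=> n n_gt0; split.
  + exact: pk0.
  + by move=> k lt_k; rewrite f_def; exact: pk_odds.
  + rewrite /pvec /fvec -map_comp f_def; apply/eq_in_map => k.
    by rewrite mem_iota => /andP[_ lt_k]; exact: pk_odds.
  + by move=> k lt_k; rewrite nth_mkseq.
  + have [s01 s12 s24] := fvec_first_blocks f n_gt0; split=> // m.
    exact: fvec_block_ends.
- split.
  + by rewrite -[pvec p 0]/[:: pk p 0 0] pk0.
  + by move=> n; rewrite size_mkseq.
  + exact: fvec0.
  + by case=> // n _; exact: fvecS.
  + exact: block_factor.
- exact: fvec_iter.
- split.
  + exact: fvec_expvec.
  + by move=> f_neq1 n; exact: expvec_log.
  + by rewrite !expvecS.
  + by split=> // n; exact: expsumS.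
  + by rewrite /= !expsumS.
Qed.
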